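(* Let $\{\mathcal T_k\}_{k\ge0}$ be the triangulations generated by successive global applications of the longest-edge altitude bisection (LEAB), starting from an initial triangulation $\mathcal T_0$ with minimal interior angle $\alpha_0>0$. Let \[ c=\min\{\operatorname{diam}(T):T\in\mathcal T_1\},\qquad C=\max\{\operatorname{diam}(T):T\in\mathcal T_1\}, \] and let $\alpha_1\ge\tfrac12\alpha_0$ denote the minimal interior angle in $\mathcal T_1$. Then for every $k\ge1$ and every $T\in\mathcal T_k$, \[ c\,(\sin\alpha_1)^{k-1}\;\le\;\operatorname{diam}(T)\;\le\;C\,(\cos\alpha_1)^{k-1}. \] In particular, $\{\mathcal T_k\}$ is uniformly refining, while the diameters of elements within a fixed level $\mathcal T_k$ may differ by arbitrarily large factors when $\alpha_0$ is small.
   Context: Longest-edge altitude bisection (LEAB): a triangle is subdivided into two triangles (its children) by the altitude dropped from the vertex opposite its longest edge. A global application of LEAB to $\mathcal T_k$ replaces every triangle of $\mathcal T_k$ by its two children, giving $\mathcal T_{k+1}$; the resulting triangulations are in general not conforming, i.e. hanging nodes may occur. The minimal interior angle of a triangulation is the smallest interior angle among all its triangles. $\operatorname{diam}(T)$ is the diameter of the triangle $T$, i.e. the length of its longest edge. *)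

(* Defs.v *)
From mathcomp Require Import all_boot all_order all_algebra.
From mathcomp Require Import all_classical all_reals all_analysis.
Import Order.TTheory GRing.Theory Num.Theory numFieldNormedType.Exports.

Set Implicit Arguments.
Unset Strict Implicit.
Unset Printing Implicit Defensive.

Local Open Scope classical_set_scope.
Local Open Scope ring_scope.

Section Triangles.
Variable R : realType.

Definition point := 'rV[R]_2.

(* The library norm on 'rV[R]_2 is the sup norm, hence the explicit Euclidean
   structure. *)
Definition dot (u v : point) : R := \sum_(j < 2) u 0 j * v 0 j.
Definition dist (p q : point) : R := Num.sqrt (dot (p - q) (p - q)).

Definition triangle := 3.-tuple point.

Implicit Types (T : triangle) (i : 'I_3) (S : seq triangle).

(* Vertex indices live in 'I_3 = Z/3Z, so that the two vertices other than
   [tnth T i] are [tnth T (i + 1)] and [tnth T (i + 2)]. *)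

(* length of the edge opposite to vertex i *)
Definition edge T i : R := dist (tnth T (i + 1)) (tnth T (i + 2)).

Definition diam T : R := \big[Num.max/0]_(i < 3) edge T i.

Definition angle T i : R :=
  acos (dot (tnth T (i + 1) - tnth T i) (tnth T (i + 2) - tnth T i)
        / (dist (tnth T (i + 1)) (tnth T i) * dist (tnth T (i + 2)) (tnth T i))).

Definition hull T : set point :=
  [set p | exists w : 'I_3 -> R,
     [/\ forall i, 0 <= w i, \sum_(i < 3) w i = 1
       & p = \sum_(i < 3) w i *: tnth T i]].

Definition nondegenerate T : Prop :=
  \det (col_mx (tnth T 1 - tnth T 0) (tnth T 2 - tnth T 0) : 'M[R]_2) != 0.

(* Conformity is not required: hanging nodes are allowed. The triangulated
   domain is the union of the triangles. *)
Definition triangulation S : Prop :=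
  [/\ S != [::],
      forall T, T \in S -> nondegenerate T
    & trivIset [set n | (n < size S)%N]
        (fun n => interior (hull (nth [tuple 0; 0; 0] S n)))].

(* The default values of the three big operators below are irrelevant for a
   nonempty S: diameters are nonnegative and at most max_diam S, and angles
   are at most pi. *)
Definition max_diam S : R := \big[Num.max/0]_(T <- S) diam T.
Definition min_diam S : R := \big[Num.min/max_diam S]_(T <- S) diam T.
Definition min_angle S : R :=
  \big[Num.min/pi]_(T <- S) \big[Num.min/pi]_(i < 3) angle T i.

(* foot of the altitude from vertex i, i.e. the orthogonal projection of that
   vertex onto the line through the other two *)
Definition foot T i : point :=
  let P := tnth T i in let Q := tnth T (i + 1) in let Q' := tnth T (i + 2) in
  Q + (dot (P - Q) (Q' - Q) / dot (Q' - Q) (Q' - Q)) *: (Q' - Q).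

Definition children T i : seq triangle :=
  [:: [tuple tnth T i; tnth T (i + 1); foot T i];
      [tuple tnth T i; foot T i; tnth T (i + 2)]].

(* When several edges of a triangle are longest, any of them may be chosen,
   so one global refinement is a relation rather than a function. *)
Definition leab_step S S' : Prop :=
  exists2 sel : triangle -> 'I_3,
    forall T, T \in S -> edge T (sel T) = diam T
    & S' = flatten [seq children T (sel T) | T <- S].

Definition leab_sequence (TT : nat -> seq triangle) : Prop :=
  triangulation (TT 0%N) /\ forall k, leab_step (TT k) (TT k.+1).

Definition uniformly_refining (TT : nat -> seq triangle) : Prop :=
  (fun k => max_diam (TT k)) @ \oo --> (0 : R).

End Triangles.

(* Main.v *)
(* The altitude onto a longest edge falls strictly inside it, so every triangle
   of level 1 is right-angled, with hypotenuse an edge of the initial triangle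
   and acute angles b, pi/2 - b for b an angle adjacent to the longest edge.
   Bisecting a right triangle with hypotenuse h and legs h s, h t gives two
   similar ones with hypotenuses h s and h t. Hence the shape (s, t) is inherited
   from level 1 on, where s, t <= cos alpha1, and each step multiplies the
   diameter by s or t. For a thin shape, always keeping the s-child or always the
   t-child yields h s^n against h t^n, whose ratio is unbounded. *)

Require Import Defs.
From mathcomp Require Import all_boot all_order all_algebra.
From mathcomp Require Import all_classical all_reals all_analysis.
From mathcomp Require Import ring lra.
Import Order.TTheory GRing.Theory Num.Theory numFieldNormedType.Exports.

Local Open Scope ring_scope.

Section Geometry.
Context {R : realType}.
Implicit Types (p q : 'rV[R]_2) (T : triangle R) (i j : 'I_3).

(** * Euclidean lengths and vertex indices modulo 3 *)

Lemma dotE (u v : 'rV[R]_2) : dot u v = u 0 0 * v 0 0 + u 0 1 * v 0 1.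
Proof.
by rewrite /dot !big_ord_recl big_ord0 addr0; congr (_ + u 0 _ * v 0 _);
  apply: val_inj.
Qed.

Lemma dot_ge0 (u : 'rV[R]_2) : 0 <= dot u u.
Proof. by rewrite dotE -!expr2 addr_ge0 ?sqr_ge0. Qed.

Lemma dist_ge0 p q : 0 <= dist p q.
Proof. exact: sqrtr_ge0. Qed.

Lemma dist_sqr p q : dist p q ^+ 2 = dot (p - q) (p - q).
Proof. exact/sqr_sqrtr/dot_ge0. Qed.

Lemma distC p q : dist p q = dist q p.
Proof. by congr Num.sqrt; rewrite !dotE !mxE; ring. Qed.

Lemma edge_ge0 T i : 0 <= edge T i.
Proof. exact: dist_ge0. Qed.

Lemma I3_cases (r i : 'I_3) : [\/ i = r, i = r + 1 | i = r + 2].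
Proof.
case: r => -[|[|[|//]]] /= ?; case: i => -[|[|[|//]]] /= ?;
  by [apply: Or31; apply: val_inj | apply: Or32; apply: val_inj
     | apply: Or33; apply: val_inj].
Qed.

Lemma I3_add11 (i : 'I_3) : i + 1 + 1 = i + 2.
Proof. by rewrite -addrA. Qed.

Lemma I3_add12 (i : 'I_3) : i + 1 + 2 = i.
Proof. by apply: val_inj; case: i => -[|[|[|]]]. Qed.

Lemma I3_add21 (i : 'I_3) : i + 2 + 1 = i.
Proof. by apply: val_inj; case: i => -[|[|[|]]]. Qed.

Lemma I3_add22 (i : 'I_3) : i + 2 + 2 = i + 1.
Proof. by apply: val_inj; case: i => -[|[|[|]]]. Qed.

Definition I3_add := (I3_add11, I3_add12, I3_add21, I3_add22).

(** * Cosines and nondegeneracy in terms of edge lengths *)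

(** The law of cosines: every angle is [acos] of a rational expression in the edge lengths, so
    geometric claims reduce to algebra. *)
Definition cosine T i : R :=
  (edge T (i + 1) ^+ 2 + edge T (i + 2) ^+ 2 - edge T i ^+ 2)
  / (2 * (edge T (i + 1) * edge T (i + 2))).

Lemma dot_edge T i :
  dot (tnth T (i + 1) - tnth T i) (tnth T (i + 2) - tnth T i) =
  (edge T (i + 1) ^+ 2 + edge T (i + 2) ^+ 2 - edge T i ^+ 2) / 2.
Proof. by rewrite /edge !dist_sqr !I3_add !dotE !mxE; field. Qed.

Lemma angleE T i : angle T i = acos (cosine T i).
Proof.
rewrite /angle dot_edge /cosine (distC (tnth T (i + 1))).
have -> : dist (tnth T i) (tnth T (i + 1)) = edge T (i + 2).
  by rewrite /edge !I3_add.
have -> : dist (tnth T (i + 2)) (tnth T i) = edge T (i + 1).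
  by rewrite /edge !I3_add.
by rewrite [edge T (i + 2) * _]mulrC -mulrA -invfM.
Qed.

Lemma det_mx2 (A : 'M[R]_2) : \det A = A 0 0 * A 1 1 - A 0 1 * A 1 0.
Proof.
rewrite (expand_det_row _ 0) !big_ord_recl big_ord0 addr0 /cofactor !det_mx11.
rewrite !mxE expr0 expr1 mul1r mulN1r mulrN.
by congr (_ * A _ _ - A _ _ * A _ _); apply: val_inj.
Qed.

(* Four times the squared area, once as a determinant and once as a Gram
   determinant at vertex [i]. *)
Lemma det_sqr_edge T i :
  \det (col_mx (tnth T 1 - tnth T 0) (tnth T 2 - tnth T 0) : 'M[R]_2) ^+ 2 =
  edge T (i + 1) ^+ 2 * edge T (i + 2) ^+ 2
  - ((edge T (i + 1) ^+ 2 + edge T (i + 2) ^+ 2 - edge T i ^+ 2) / 2) ^+ 2.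
Proof.
set A := col_mx _ _.
have A0 k : A 0 k = tnth T 1 0 k - tnth T 0 0 k.
  have -> : (0 : 'I_2) = @lshift 1 1 0 by apply: val_inj.
  by rewrite col_mxEu !mxE.
have A1 k : A 1 k = tnth T 2 0 k - tnth T 0 0 k.
  have -> : (1 : 'I_2) = @rshift 1 1 0 by apply: val_inj.
  by rewrite col_mxEd !mxE.
rewrite det_mx2 !A0 !A1 /edge !dist_sqr !I3_add !dotE !mxE.
have [->|->|->] := I3_cases 0 i; rewrite ?I3_add ?add0r; by field.
Qed.

Lemma nondegenerate_edge_gt0 T i : Defs.nondegenerate T -> 0 < edge T i.
Proof.
move=> nd; rewrite lt0r edge_ge0 andbT; apply/eqP => e0.
(* Vertex [i + 2] is an end of the vanishing edge, so the squared determinant equals minus a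
   square. *)
have := det_sqr_edge T (i + 2).
rewrite !I3_add e0 expr0n mul0r sub0r => /eqP.
by rewrite -subr_eq0 opprK paddr_eq0 ?sqr_ge0 // sqrf_eq0 (negPf nd).
Qed.

(** Strict Cauchy-Schwarz: the Gram determinant at vertex [i] is positive. *)
Lemma nondegenerate_cosine_lt1 T i : Defs.nondegenerate T -> cosine T i ^+ 2 < 1.
Proof.
move=> nd; have b0 := nondegenerate_edge_gt0 T (i + 1) nd.
have c0 := nondegenerate_edge_gt0 T (i + 2) nd.
have : 0 < \det (col_mx (tnth T 1 - tnth T 0)
                        (tnth T 2 - tnth T 0) : 'M[R]_2) ^+ 2.
  by rewrite lt0r sqrf_eq0 nd sqr_ge0.
rewrite (det_sqr_edge T i) /cosine subr_gt0 => H.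
rewrite exprMn exprVn ltr_pdivrMr ?mul1r ?exprn_gt0 ?mulr_gt0 //; nra.
Qed.

Lemma diam_ge T i : edge T i <= diam T.
Proof. exact: (le_bigmax _ (edge T)). Qed.

(** * Right triangles of a given shape *)

(** The size [h] is kept apart from the shape [(s, t)], the cosines of the acute angles, because
    bisection changes only the size. The right angle at [r] is implied by the lengths; the
    disjunction disregards orientation. *)
Definition right_triangle T (h s t : R) : Prop :=
  [/\ 0 < h, 0 < s, 0 < t, s ^+ 2 + t ^+ 2 = 1
    & exists r, edge T r = h /\
        (edge T (r + 1) = h * s /\ edge T (r + 2) = h * t \/
         edge T (r + 1) = h * t /\ edge T (r + 2) = h * s)].

Lemma right_triangleC T h s t : right_triangle T h s t -> right_triangle T h t s.
Proof.
case=> h0 s0 t0 st [r [er H]]; split; rewrite 1?addrC //.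
by exists r; split=> //; case: H; [right|left].
Qed.

Lemma right_triangle_intro T r h s t :
  0 < h -> 0 < s -> 0 < t -> s ^+ 2 + t ^+ 2 = 1 -> edge T r = h ->
  edge T (r + 1) ^+ 2 = (h * s) ^+ 2 -> edge T (r + 2) ^+ 2 = (h * t) ^+ 2 ->
  right_triangle T h s t.
Proof.
move=> h0 s0 t0 st er e1 e2; split=> //; exists r; split=> //; left.
by split; apply/eqP; rewrite -(@eqrXn2 _ 2) ?edge_ge0 ?mulr_ge0 ?ltW //;
  apply/eqP.
Qed.

Lemma right_triangle_legs_lt1 {T h s t} : right_triangle T h s t -> s < 1 /\ t < 1.
Proof. by case=> _ s0 t0 st _; split; nra. Qed.

Lemma diam_right_triangle {T h s t} : right_triangle T h s t -> diam T = h.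
Proof.
move=> H; have [s1 t1] := right_triangle_legs_lt1 H.
case: H => h0 s0 t0 st [r [er H]]; apply/eqP; rewrite eq_le -{2}er diam_ge andbT.
apply: bigmax_le => [|i _]; first exact: ltW.
by have [->|->|->] := I3_cases r i; case: H => -[e1 e2]; rewrite ?er ?e1 ?e2; nra.
Qed.

(** The legs are strictly shorter than [h], so an edge of length [h] can only be the hypotenuse: the
    choice of a longest edge is forced. *)
Lemma right_triangle_cosines {T h s t} (r : 'I_3) :
  edge T r = h -> right_triangle T h s t ->
  cosine T r = 0 /\
  ([/\ edge T (r + 1) = h * t, edge T (r + 2) = h * s,
       cosine T (r + 1) = s & cosine T (r + 2) = t] \/
   [/\ edge T (r + 1) = h * s, edge T (r + 2) = h * t,
       cosine T (r + 1) = t & cosine T (r + 2) = s]).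
Proof.
move=> er H; have [s1 t1] := right_triangle_legs_lt1 H.
case: H => h0 s0 t0 st [r' [er' H]].
have [hs ht] : h * s < h /\ h * t < h by rewrite !gtr_pMr.
have rr : r = r'.
  by have [//|ri|ri] := I3_cases r' r; exfalso; move: er; rewrite ri;
    case: H => -[e1 e2]; rewrite ?e1 ?e2 => e; lra.
subst r'; have hE : h ^+ 2 = (h * s) ^+ 2 + (h * t) ^+ 2.
  by rewrite !exprMn -mulrDr st mulr1.
have [nh ns nt] : [/\ h != 0, s != 0 & t != 0] by rewrite !gt_eqF.
rewrite /cosine !I3_add.
by case: H => -[-> ->]; rewrite er hE;
  (split; [|by [left; split=> //; field; rewrite ?nh ?ns ?nt
               |right; split=> //; field; rewrite ?nh ?ns ?nt]]);
  field; rewrite ?nh ?ns ?nt.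
Qed.

(** * The foot of the altitude and the two children *)

Lemma dotC (u v : 'rV[R]_2) : dot u v = dot v u.
Proof. by rewrite !dotE mulrC [_ 0 1 * _]mulrC. Qed.

Lemma projection_dist (P Q Q' : 'rV[R]_2) :
  dist Q Q' != 0 ->
  let t := dot (P - Q) (Q' - Q) / dot (Q' - Q) (Q' - Q) in
  let F := Q + t *: (Q' - Q) in
  [/\ dist Q F ^+ 2 = t ^+ 2 * dist Q Q' ^+ 2,
      dist F Q' ^+ 2 = (1 - t) ^+ 2 * dist Q Q' ^+ 2
    & dist F P ^+ 2 = dist P Q ^+ 2 - t ^+ 2 * dist Q Q' ^+ 2].
Proof.
move=> d0 t F; have d2 : dot (Q' - Q) (Q' - Q) != 0.
  by rewrite -dist_sqr distC expf_neq0.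
have tE : t * dot (Q' - Q) (Q' - Q) = dot (P - Q) (Q' - Q) by rewrite divfK.
(* From here on [t] is known only through [tE], which says that [P - F] is orthogonal to
   [Q' - Q]. *)
clearbody t.
have -> : dist F P ^+ 2 = dist P Q ^+ 2 - 2 * t * dot (P - Q) (Q' - Q)
    + t ^+ 2 * dist Q Q' ^+ 2.
  by rewrite /F !dist_sqr !dotE !mxE; ring.
rewrite -tE -dist_sqr (distC Q'); split; [| |ring];
  by rewrite /F !dist_sqr !dotE !mxE; ring.
Qed.

(** With [c = edge T (j + 2)], [b = edge T (j + 1)] and B, C the angles at [j + 1], [j + 2], the
    base pieces are c cos B and b cos C, and the altitude is c sin B = b sin C. Squaring spares the
    signs of the cosines. *)
Lemma foot_dist T j :
  (forall i, 0 < edge T i) ->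
  let u := cosine T (j + 1) in let v := cosine T (j + 2) in
  [/\ dist (tnth T (j + 1)) (foot T j) ^+ 2 = (edge T (j + 2) * u) ^+ 2,
      dist (foot T j) (tnth T (j + 2)) ^+ 2 = (edge T (j + 1) * v) ^+ 2,
      dist (foot T j) (tnth T j) ^+ 2 = edge T (j + 2) ^+ 2 * (1 - u ^+ 2)
    & dist (foot T j) (tnth T j) ^+ 2 = edge T (j + 1) ^+ 2 * (1 - v ^+ 2)].
Proof.
move=> e0 u v; have e0' i : edge T i != 0 by rewrite gt_eqF.
have dE : dot (tnth T j - tnth T (j + 1)) (tnth T (j + 2) - tnth T (j + 1)) =
    (edge T (j + 2) ^+ 2 + edge T j ^+ 2 - edge T (j + 1) ^+ 2) / 2.
  by have := dot_edge T (j + 1); rewrite !I3_add dotC.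
have ddE : dot (tnth T (j + 2) - tnth T (j + 1)) (tnth T (j + 2) - tnth T (j + 1))
    = edge T j ^+ 2 by rewrite -dist_sqr distC.
have cE : dist (tnth T j) (tnth T (j + 1)) = edge T (j + 2) by rewrite /edge !I3_add.
have := projection_dist (tnth T j) _ _ (e0' j).
rewrite /foot dE ddE cE -/(edge T j) => -[-> -> ->].
rewrite /u /v /cosine !I3_add.
by split; field; rewrite ?e0'.
Qed.

Lemma children_right T j :
  (forall i, 0 < edge T i) ->
  let u := cosine T (j + 1) in let v := cosine T (j + 2) in
  0 < u < 1 -> 0 < v < 1 ->
  exists T1 T2,
    [/\ children T j = [:: T1; T2],
        right_triangle T1 (edge T (j + 2)) u (Num.sqrt (1 - u ^+ 2))
      & right_triangle T2 (edge T (j + 1)) v (Num.sqrt (1 - v ^+ 2))].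
Proof.
move=> e0 u v /andP[u0 u1] /andP[v0 v1].
have sq (x : R) : 0 < x -> x < 1 -> 0 < 1 - x ^+ 2 by move=> *; nra.
have su := sq _ u0 u1; have sv := sq _ v0 v1.
have := foot_dist T j e0; rewrite /= -/u -/v => -[f1 f2 f3 f4].
exists [tuple tnth T j; tnth T (j + 1); foot T j].
exists [tuple tnth T j; foot T j; tnth T (j + 2)].
split=> //.
(* The foot carries the right angle: it has index 2 in this child and index 1 in the other. *)
- apply: (@right_triangle_intro _ 2).
  + exact: e0.
  + by [].
  + by rewrite sqrtr_gt0.
  + by rewrite sqr_sqrtr ?ltW // addrC subrK.
  + by rewrite /edge !I3_add.
  + exact: f1.
  + by rewrite [RHS]exprMn (sqr_sqrtr (ltW su)) -f3.
- apply/right_triangleC; apply: (@right_triangle_intro _ 1).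
  + exact: e0.
  + by rewrite sqrtr_gt0.
  + by [].
  + by rewrite sqr_sqrtr ?ltW // subrK.
  + by rewrite /edge !I3_add.
  + by rewrite [RHS]exprMn (sqr_sqrtr (ltW sv)) -f4 distC.
  + exact: f2.
Qed.

(** Each leg becomes the hypotenuse of a child that keeps the acute angle at its end. Since the root
    of [1 - s ^+ 2] is [t], the shape recurs and only the size is scaled. *)
Lemma right_triangle_children T h s t j :
  right_triangle T h s t -> edge T j = diam T ->
  exists T1 T2, children T j = [:: T1; T2] /\
    (right_triangle T1 (h * s) s t /\ right_triangle T2 (h * t) s t \/
     right_triangle T1 (h * t) s t /\ right_triangle T2 (h * s) s t).
Proof.
move=> H ej; have [s1 t1] := right_triangle_legs_lt1 H.
rewrite (diam_right_triangle H) in ej.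
have [_ cosE] := right_triangle_cosines j ej H.
case: (H) => h0 s0 t0 st _.
have e0 i : 0 < edge T i.
  by have [->|->|->] := I3_cases j i; case: cosE => -[e1 e2 _ _];
    rewrite ?ej ?e1 ?e2 ?mulr_gt0.
have sqrtE (x y : R) : 0 < y -> x ^+ 2 + y ^+ 2 = 1 -> Num.sqrt (1 - x ^+ 2) = y.
  by move=> y0 <-; rewrite addrC addKr sqrtr_sqr ger0_norm ?ltW.
have := children_right T j e0; rewrite /=.
case: cosE => -[-> -> -> ->]; rewrite s0 s1 t0 t1 => /(_ isT isT) [T1 [T2 [-> ]]].
  rewrite (sqrtE s t) // (sqrtE t s) 1?addrC // => r1 /right_triangleC r2.
  by exists T1, T2; split=> //; left.
rewrite (sqrtE s t) // (sqrtE t s) 1?addrC // => /right_triangleC r1 r2.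
by exists T1, T2; split=> //; right.
Qed.

(** No edge exceeds the one opposite [j], so the cosines at its two ends have positive numerators:
    both angles are acute and the foot falls strictly between them. *)
Lemma nondegenerate_children T j :
  Defs.nondegenerate T -> edge T j = diam T ->
  let u := cosine T (j + 1) in let v := cosine T (j + 2) in
  exists T1 T2,
    [/\ children T j = [:: T1; T2],
        right_triangle T1 (edge T (j + 2)) u (Num.sqrt (1 - u ^+ 2))
      & right_triangle T2 (edge T (j + 1)) v (Num.sqrt (1 - v ^+ 2))].
Proof.
move=> nd ej u v.
have e0 i : 0 < edge T i by apply: nondegenerate_edge_gt0.
have le i : edge T i <= edge T j by rewrite ej diam_ge.
have cos01 i : 0 < cosine T i -> 0 < cosine T i < 1.
  by move=> i0; rewrite i0 /=; have := nondegenerate_cosine_lt1 T i nd; nra.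
apply: children_right => //; apply: cos01; rewrite /cosine divr_gt0 //;
  rewrite ?mulr_gt0 // !I3_add.
- by have := e0 (j + 2); have := e0 (j + 1); have := le (j + 1); nra.
- by have := e0 (j + 2); have := e0 (j + 1); have := le (j + 2); nra.
Qed.

(** * Minimal angles and their behaviour under one bisection *)

Lemma le_acos (a x : R) :
  0 <= a <= pi -> -1 <= x <= 1 -> (a <= acos x) = (x <= cos a).
Proof.
move=> a01 x01; have [ax0 axE] := acos_def x01.
by rewrite -[in RHS]axE !leNgt ltr_cos // in_itv.
Qed.

Lemma min_angle_le S T i : T \in S -> min_angle S <= angle T i.
Proof.
move=> TS; apply: le_trans (bigmin_le pi i (angle T)).
exact: (ge_bigmin_seq _ T xpredT (fun T => \big[Num.min/pi]_(i < 3) angle T i)).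
Qed.

Lemma min_angle_le_pi (S : seq (triangle R)) : min_angle S <= pi.
Proof. exact: bigmin_le_id. Qed.

Lemma min_angle_ge S (a : R) :
  a <= pi -> (forall T i, T \in S -> a <= angle T i) -> a <= min_angle S.
Proof.
move=> api aS; rewrite /min_angle big_seq; apply: le_bigmin => // T TS.
by apply: le_bigmin => // i _; apply: aS.
Qed.

Lemma min_angle_lt S (a : R) :
  a <= pi -> min_angle S < a -> exists T i, T \in S /\ angle T i < a.
Proof.
move=> api Sa; apply: contrapT => noT; move: Sa.
rewrite ltNge min_angle_ge // => T i TS.
by rewrite leNgt; apply/negP => Ta; apply: noT; exists T, i.
Qed.

(** The right angle is at least [a] because [a <= pi / 2]; the other two are [acos s] and [acos t],
    and cosine decreases on [0, pi]. *)
Lemma right_triangle_angle_ge T h s t (a : R) :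
  0 <= a <= pi / 2 -> right_triangle T h s t ->
  (forall i, a <= angle T i) <-> s <= cos a /\ t <= cos a.
Proof.
move=> /andP[a0 api] H; have [s1 t1] := right_triangle_legs_lt1 H.
have [h0 s0 t0 _ [r [er _]]] := H.
have [c0 cs] := right_triangle_cosines r er H.
have api' : 0 <= a <= pi by rewrite a0 /=; have := pi_gt0 R; lra.
have sE : (a <= acos s) = (s <= cos a) by apply: le_acos => //; apply/andP; lra.
have tE : (a <= acos t) = (t <= cos a) by apply: le_acos => //; apply/andP; lra.
split=> [ai|[sa ta] i].
  rewrite -sE -tE.
  by case: cs => -[_ _ <- <-]; rewrite -!angleE !ai.
have [->|->|->] := I3_cases r i; rewrite angleE ?c0 ?acos0 //;
  by case: cs => -[_ _ c1 c2]; rewrite ?c1 ?c2 ?sE ?tE.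
Qed.

(* Here [u = cos B] and [v = cos C] for the angles at the ends of the longest edge
   [c u + b v]. Since [A >= B], [2 B + C <= pi], so [C/2 <= pi/2 - B] and
   [sin B <= cos (C/2)], which is squared here. *)
Lemma triangle_cosine_ineq (b c u v : R) :
  0 < b -> 0 < u < 1 -> -1 < v < 1 ->
  c ^+ 2 * (1 - u ^+ 2) = b ^+ 2 * (1 - v ^+ 2) -> b <= c * u + b * v ->
  1 - u ^+ 2 <= (1 + v) / 2.
Proof.
move=> b0 /andP[u0 u1] /andP[v0 v1] H le.
have le2 : b ^+ 2 * (1 - v) ^+ 2 <= c ^+ 2 * u ^+ 2.
  rewrite -!exprMn ler_pXn2r ?nnegrE //; nra.
have u21 : 0 <= 1 - u ^+ 2 by nra.
(* Multiply [le2] by [1 - u ^+ 2] and exchange the altitude by [H]; the positive factor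
   [b ^+ 2 * (1 - v)] then cancels. *)
have : (1 - u ^+ 2) * (b ^+ 2 * (1 - v) ^+ 2) <= u ^+ 2 * (b ^+ 2 * (1 - v ^+ 2)).
  by rewrite -H [leRHS]mulrCA mulrA [leRHS]mulrC; apply: ler_wpM2l.
have -> : (1 - u ^+ 2) * (b ^+ 2 * (1 - v) ^+ 2) =
    (b ^+ 2 * (1 - v)) * ((1 - u ^+ 2) * (1 - v)) by ring.
have -> : u ^+ 2 * (b ^+ 2 * (1 - v ^+ 2)) =
    (b ^+ 2 * (1 - v)) * (u ^+ 2 * (1 + v)) by ring.
rewrite ler_pM2l; last by rewrite mulr_gt0 ?exprn_gt0 // subr_gt0.
by move=> ?; lra.
Qed.

Lemma cos_half_sqr (a : R) : cos (a / 2) ^+ 2 = (1 + cos a) / 2.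
Proof.
have aE : a = (a / 2) *+ 2 by rewrite -mulr_natr divfK ?pnatr_eq0.
by rewrite [in RHS]aE cos_mulr2n; field.
Qed.

(** Besides its right angle, a child has a base angle B of the parent and the complement of B. The
    first is at least [a]; by [triangle_cosine_ineq] the second is at least half the other base
    angle. *)
Lemma child_angle_ge T j T' (a : R) :
  Defs.nondegenerate T -> edge T j = diam T -> 0 <= a ->
  (forall i, a <= angle T i) ->
  T' \in children T j -> forall i, a / 2 <= angle T' i.
Proof.
move=> nd ej a0 aT.
have e0 i : 0 < edge T i by apply: nondegenerate_edge_gt0.
have le i : edge T i <= edge T j by rewrite ej diam_ge.
have cosb i : -1 < cosine T i < 1.
  by have := nondegenerate_cosine_lt1 T i nd; nra.
have api : a <= pi.
  apply: le_trans (aT 0) _; rewrite angleE acos_lepi //.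
  by case/andP: (cosb 0) => *; apply/andP; split; apply: ltW.
have ca i : cosine T i <= cos a.
  rewrite -le_acos -?angleE ?a0 //.
  by case/andP: (cosb i) => *; apply/andP; split; apply: ltW.
have a2 : 0 <= a / 2 <= pi / 2 by lra.
have cha : 0 <= cos (a / 2).
  by apply: cos_ge0_pihalf; have := pi_gt0 R; lra.
have cosa2 : cos a <= cos (a / 2).
  by have := cos_half_sqr a; have := cos_le1 (a / 2); nra.
have [T1 [T2 [-> r1 r2]]] := nondegenerate_children T j nd ej.
have [_ u0 _ _ _] := r1; have [_ v0 _ _ _] := r2.
have [/andP[_ u1] /andP[_ v1]] := (cosb (j + 1), cosb (j + 2)).
(* Both sides are the squared altitude; [aE] below splits the longest edge at the foot. *)
have H : edge T (j + 2) ^+ 2 * (1 - cosine T (j + 1) ^+ 2)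
       = edge T (j + 1) ^+ 2 * (1 - cosine T (j + 2) ^+ 2).
  by rewrite /cosine !I3_add; field; rewrite !gt_eqF.
have aE : edge T j = edge T (j + 2) * cosine T (j + 1)
                     + edge T (j + 1) * cosine T (j + 2).
  by rewrite /cosine !I3_add; field; rewrite !gt_eqF.
have bound (x y : R) : x <= cos a -> 1 - y ^+ 2 <= (1 + x) / 2 ->
    Num.sqrt (1 - y ^+ 2) <= cos (a / 2).
  move=> xa yx; rewrite -(@ler_pXn2r _ 2) ?nnegrE ?sqrtr_ge0 //.
  (* [Num.sqrt] is 0 on a negative argument. *)
  have [neg|pos] := ltrP (1 - y ^+ 2) 0.
    by rewrite ltr0_sqrtr // expr0n sqr_ge0.
  by rewrite sqr_sqrtr // cos_half_sqr; lra.
rewrite !inE => /orP[]/eqP ->.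
- apply/(right_triangle_angle_ge _ _ _ _ _ a2 r1); split.
    exact: le_trans (ca _) cosa2.
  apply: (bound (cosine T (j + 2))) => //.
  apply: (@triangle_cosine_ineq (edge T (j + 1)) (edge T (j + 2)));
    rewrite ?u0 ?cosb //.
  by rewrite -aE.
- apply/(right_triangle_angle_ge _ _ _ _ _ a2 r2); split.
    exact: le_trans (ca _) cosa2.
  apply: (bound (cosine T (j + 1))) => //.
  apply: (@triangle_cosine_ineq (edge T (j + 2)) (edge T (j + 1)));
    rewrite ?v0 ?cosb //.
  by rewrite [leRHS]addrC -aE.
Qed.

(** * Refinement steps and descendants of thin right triangles *)

Lemma leab_step_mem S S' T' :
  leab_step S S' -> T' \in S' ->
  exists T j, [/\ T \in S, edge T j = diam T & T' \in children T j].
Proof.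
move=> [sel selP ->] /flatten_mapP[T TS T'c].
by exists T, (sel T); split=> //; apply: selP.
Qed.

Lemma leab_step_children S S' T :
  leab_step S S' -> T \in S ->
  exists j, edge T j = diam T /\ {subset children T j <= S'}.
Proof.
move=> [sel selP ->] TS; exists (sel T); split; first exact: selP.
by move=> T' T'c; apply/flatten_mapP; exists T.
Qed.

(** Follow the child scaled by [s] at every step; exchanging [s] and [t] gives the other extreme. *)
Lemma right_triangle_descendant (TT : nat -> seq (triangle R)) k n T h s t :
  (forall k, leab_step (TT k) (TT k.+1)) -> T \in TT k ->
  right_triangle T h s t ->
  exists2 T', T' \in TT (k + n)%N & right_triangle T' (h * s ^+ n) s t.
Proof.
move=> step TS rT; elim: n => [|n [T' T'S rT']].
  by exists T; rewrite ?addn0 ?mulr1.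
have [j [ej sub]] := leab_step_children _ _ _ (step (k + n)%N) T'S.
have [T1 [T2 [cE]]] := right_triangle_children T' _ s t j rT' ej.
rewrite addnS exprSr mulrA; case=> -[r1 r2].
  by exists T1 => //; apply: sub; rewrite cE mem_head.
by exists T2 => //; apply: sub; rewrite cE !inE eqxx orbT.
Qed.

(** The two extreme descendants have diameters h s^n and h t^n. With m = max(M, 1), m t < s gives
    m^n t^n < s^n, and M <= m <= m^n since m >= 1 and n > 0. *)
Lemma right_triangle_disparity (TT : nat -> seq (triangle R)) k n T h s t M :
  (forall k, leab_step (TT k) (TT k.+1)) -> T \in TT k ->
  right_triangle T h s t -> Num.max M 1 * t < s -> (0 < n)%N ->
  exists T1 T2 : triangle R,
    [/\ T1 \in TT (k + n)%N, T2 \in TT (k + n)%N & M * diam T2 < diam T1].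
Proof.
move=> step TS rT Mst n0.
have [T1 T1S r1] := right_triangle_descendant TT k n T h s t step TS rT.
have [T2 T2S r2] :=
  right_triangle_descendant TT k n T h t s step TS (right_triangleC _ _ _ _ rT).
exists T1, T2; split=> //.
have [h0 s0 t0 _ _] := rT.
rewrite (diam_right_triangle r1) (diam_right_triangle r2) mulrCA ltr_pM2l //.
have M1 : 1 <= Num.max M 1 by rewrite le_max lexx orbT.
have : (Num.max M 1 * t) ^+ n < s ^+ n.
  by rewrite ltr_pXn2r ?nnegrE ?mulr_ge0 ?(le_trans ler01 M1) ?ltW.
apply: le_lt_trans; rewrite exprMn ler_pM2r ?exprn_gt0 //.
apply: (@le_trans _ _ (Num.max M 1)); first by rewrite le_max lexx.
by rewrite ler_eXnr.
Qed.

Lemma min_diam_le S T : T \in S -> min_diam S <= diam T.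
Proof. by move=> TS; exact: (ge_bigmin_seq _ T xpredT (fun T => diam T)). Qed.

Lemma max_diam_ge S T : T \in S -> diam T <= max_diam S.
Proof. by move=> TS; exact: (le_bigmax_seq _ T xpredT (fun T => diam T)). Qed.

Lemma max_diam_ge0 (S : seq (triangle R)) : 0 <= max_diam S.
Proof. exact: bigmax_ge_id. Qed.

(** * Diameter bounds along a LEAB sequence *)

Section Sequence.
Variable TT : nat -> seq (triangle R).
Hypothesis leab_TT : leab_sequence TT.
Hypothesis alpha0_gt0 : 0 < min_angle (TT 0%N).
Local Notation alpha1 := (min_angle (TT 1%N)).

Lemma half_alpha0_le_alpha1 : min_angle (TT 0%N) / 2 <= alpha1.
Proof.
have [[_ nd _] step] := leab_TT.
have := min_angle_le_pi (TT 0%N) => api.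
apply: min_angle_ge; first by have := pi_gt0 R; lra.
move=> T' i /(leab_step_mem _ _ _ (step 0%N))[T [j [TS ej T'c]]].
apply: (child_angle_ge T j) => //; [exact: nd | exact: ltW |].
by move=> k; apply: min_angle_le.
Qed.

Lemma alpha1_gt0 : 0 < alpha1.
Proof. by apply: lt_le_trans half_alpha0_le_alpha1; rewrite divr_gt0. Qed.

Lemma alpha1_le_pihalf (T : triangle R) h s t :
  T \in TT 1%N -> right_triangle T h s t -> alpha1 <= pi / 2.
Proof.
move=> TS rT; have [_ _ _ _ [r [er _]]] := rT.
have [c0 _] := right_triangle_cosines r er rT.
by have := min_angle_le _ _ r TS; rewrite angleE c0 acos0.
Qed.

(** Induction with the shape in the invariant: level 1 bounds [s] and [t] by [cos alpha1], all
    descendants inherit them, and each later level contributes one factor, hence exponent [k] at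
    level [k.+1]. *)
Lemma leab_right_triangle k T :
  T \in TT k.+1 ->
  exists h s t,
    [/\ right_triangle T h s t, s <= cos alpha1, t <= cos alpha1,
        min_diam (TT 1%N) * sin alpha1 ^+ k <= h
      & h <= max_diam (TT 1%N) * cos alpha1 ^+ k].
Proof.
have [[_ nd _] step] := leab_TT.
elim: k T => [|k IHk] T TS.
  have [T0 [j [T0S ej Tc]]] := leab_step_mem _ _ _ (step 0%N) TS.
  have [T1 [T2 [cE r1 r2]]] := nondegenerate_children T0 j (nd _ T0S) ej.
  have [h [s [t rT]]] : exists h s t, right_triangle T h s t.
    move: Tc; rewrite cE !inE => /orP[]/eqP ->; do 3 eexists;
      [exact: r1 | exact: r2].
  have api := alpha1_le_pihalf _ _ _ _ TS rT.
  have a2 : 0 <= alpha1 <= pi / 2 by rewrite api ltW ?alpha1_gt0.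
  have [sa ta] := (right_triangle_angle_ge _ _ _ _ _ a2 rT).1
    (min_angle_le _ _ ^~ TS).
  exists h, s, t; split=> //; rewrite -(diam_right_triangle rT) expr0 mulr1.
    exact: min_diam_le.
  exact: max_diam_ge.
have [T0 [j [T0S ej Tc]]] := leab_step_mem _ _ _ (step k.+1) TS.
have [h [s [t [rT0 sa ta lo up]]]] := IHk _ T0S.
have [h0 s0 t0 st _] := rT0.
have sin0 : 0 <= sin alpha1.
  by rewrite sin_ge0_pi // min_angle_le_pi ltW // alpha1_gt0.
(* Since the squares of [s] and [t] sum to 1, an upper bound on one is a lower bound on the
   other. *)
have sin_le (x y : R) : 0 < x -> 0 < y -> x ^+ 2 + y ^+ 2 = 1 ->
    x <= cos alpha1 -> sin alpha1 <= y.
  move=> x0 y0 xy xa; rewrite -(@ler_pXn2r _ 2) ?nnegrE ?(ltW y0) //.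
  have : x ^+ 2 <= cos alpha1 ^+ 2 by rewrite ler_pXn2r ?nnegrE //; lra.
  by have := cos2Dsin2 alpha1; lra.
have key x : x \in [:: s; t] -> right_triangle T (h * x) s t ->
  exists h s t,
    [/\ right_triangle T h s t, s <= cos alpha1, t <= cos alpha1,
        min_diam (TT 1%N) * sin alpha1 ^+ k.+1 <= h
      & h <= max_diam (TT 1%N) * cos alpha1 ^+ k.+1].
  move=> xst rT.
  have [x0 xc xs] : [/\ 0 < x, x <= cos alpha1 & sin alpha1 <= x].
    move: xst; rewrite !inE => /orP[]/eqP ->; split=> //.
    - by apply: (sin_le t) => //; rewrite addrC.
    - exact: (sin_le s).
  exists (h * x), s, t; split=> //; rewrite exprSr mulrA.
  - apply: le_trans (ler_wpM2r sin0 lo) _.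
    by rewrite ler_pM2l.
  - apply: le_trans (ler_wpM2l (ltW h0) xc) _.
    by apply: ler_wpM2r up; apply: le_trans xc; apply: ltW.
have [T1 [T2 [cE rT]]] := right_triangle_children _ _ _ _ _ rT0 ej.
have key_s : right_triangle T (h * s) s t -> _ := key s (mem_head s [:: t]).
have key_t : right_triangle T (h * t) s t -> _ := key t (mem_last s [:: t]).
by move: Tc key_s key_t; rewrite cE !inE => /orP[]/eqP ->;
  case: rT => -[r1 r2]; auto.
Qed.

Lemma leab_uniformly_refining : uniformly_refining TT.
Proof.
have [[S0 nd _] step] := leab_TT.
have [cos0 cos1] : 0 <= cos alpha1 /\ cos alpha1 < 1.
  split; last first.
    by rewrite -cos0 ltr_cos ?in_itv /= ?lexx ?pi_ge0
      ?min_angle_le_pi ?ltW ?alpha1_gt0.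
  (* A triangle of level 0 has a child with a right angle in level 1, whence [alpha1 <= pi / 2]. *)
  case E : (TT 0%N) S0 => [//|T S] _.
  have TS : T \in TT 0%N by rewrite E mem_head.
  have [j [ej sub]] := leab_step_children _ _ _ (step 0%N) TS.
  have [T1 [T2 [cE r1 _]]] := nondegenerate_children T j (nd _ TS) ej.
  have T1S : T1 \in TT 1%N by apply: sub; rewrite cE mem_head.
  have api := alpha1_le_pihalf _ _ _ _ T1S r1.
  apply: cos_ge0_pihalf; rewrite api andbT.
  by have := alpha1_gt0; have := pi_gt0 R; lra.
(* The geometric bound starts at level 1, so the sequence is shifted before squeezing. *)
rewrite /uniformly_refining -cvg_shiftS.
apply: (@squeeze_cvgr _ _ _ _ (cst 0) (geometric (max_diam (TT 1%N)) (cos alpha1))).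
- apply: nearW => k /=; rewrite max_diam_ge0 /=.
  rewrite {1}/max_diam big_seq; apply: bigmax_le => [|T TS].
    by rewrite mulr_ge0 ?max_diam_ge0 ?exprn_ge0.
  have [h [s [t [rT _ _ _ up]]]] := leab_right_triangle _ _ TS.
  by rewrite (diam_right_triangle rT).
- exact: cvg_cst.
- by apply: cvg_geometric; rewrite ger0_norm.
Qed.

End Sequence.

(** * Thin angles and explicit thin triangulations *)

(** Take tan delta = 1/m with m = max(M, 1): on the unit circle an angle below delta has t/s < 1/m.
    The bound 1/2 later excludes a thin angle opposite a longest edge. *)
Lemma cos_close_to_one (M : R) :
  exists delta : R, [/\ 0 < delta, delta <= pi, 1 / 2 <= cos delta
    & forall s t, 0 < s -> 0 < t -> s ^+ 2 + t ^+ 2 = 1 ->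
        cos delta < s -> Num.max M 1 * t < s].
Proof.
set m := Num.max M 1; have m1 : 1 <= m by rewrite le_max lexx orbT.
set q := Num.sqrt (1 + m ^+ 2).
have q0 : 0 < q by rewrite sqrtr_gt0; nra.
have q2 : q ^+ 2 = 1 + m ^+ 2 by rewrite sqr_sqrtr //; nra.
have mq : m < q by nra.
have qm : q <= 2 * m by nra.
have x1 : m / q < 1 by rewrite ltr_pdivrMr ?mul1r.
have x2 : 1 / 2 <= m / q by rewrite ler_pdivlMr //; lra.
have x3 : -1 <= m / q <= 1 by apply/andP; lra.
have [_ cE] := acos_def x3.
exists (acos (m / q)); split.
- by apply: acos_gt0; apply/andP; lra.
- exact: acos_lepi.
- by rewrite cE.
move=> s t s0 t0 st; rewrite cE ltr_pdivrMr // => ms.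
have ms2 : m ^+ 2 < s ^+ 2 * (1 + m ^+ 2).
  by rewrite -q2 -exprMn ltr_pXn2r ?nnegrE //; nra.
rewrite -(@ltr_pXn2r _ 2) ?nnegrE ?mulr_ge0 ?ltW //; nra.
Qed.

Lemma exists_leab_sequence (S : seq (triangle R)) :
  triangulation S -> exists TT, leab_sequence TT /\ TT 0%N = S.
Proof.
move=> triS; pose sel T := [arg max_(i > 0 : 'I_3) edge T i]%O.
pose next S' := flatten [seq children T (sel T) | T <- S'].
exists (fun k => iter k next S); split=> //; split=> // k.
exists sel => // T _.
rewrite /diam (bigmax_eq_arg _ 0) // => i _; exact: edge_ge0.
Qed.

Definition right_triangle_of_angle (phi : R) : triangle R :=
  [tuple 0; cos phi *: delta_mx 0 0; sin phi *: delta_mx 0 1].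

Lemma right_triangle_of_angleP (phi : R) :
  0 < cos phi -> 0 < sin phi ->
  right_triangle (right_triangle_of_angle phi) 1 (cos phi) (sin phi).
Proof.
move=> c0 s0; apply/right_triangleC.
apply: (@right_triangle_intro _ 0) => //.
- by rewrite addrC cos2Dsin2.
- rewrite /edge /dist dotE !mxE /= -[RHS]sqrtr1; congr Num.sqrt.
  by rewrite -[RHS](cos2Dsin2 phi); ring.
- by rewrite /edge dist_sqr dotE !mxE /=; ring.
- by rewrite /edge dist_sqr dotE !mxE /=; ring.
Qed.

Lemma right_triangle_nondegenerate {T h s t} :
  right_triangle T h s t -> Defs.nondegenerate T.
Proof.
case=> h0 s0 t0 st [r [er leg]]; rewrite /Defs.nondegenerate -sqrf_eq0.
have hE : h ^+ 2 = (h * s) ^+ 2 + (h * t) ^+ 2.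
  by rewrite !exprMn -mulrDr st mulr1.
(* At the right angle the dot product vanishes, leaving the product of the squared legs. *)
rewrite (det_sqr_edge T r) er hE gt_eqF //.
have hs : 0 < h * s by rewrite mulr_gt0.
have ht : 0 < h * t by rewrite mulr_gt0.
by case: leg => -[-> ->]; rewrite [X in X / 2](_ : _ = 0)
  ?mul0r ?expr0n ?subr0 ?mulr_gt0 ?exprn_gt0 //; ring.
Qed.

Lemma triangulation1 (T : triangle R) : Defs.nondegenerate T -> triangulation [:: T].
Proof.
move=> nd; split=> //; first by move=> T'; rewrite inE => /eqP ->.
by move=> [|i] [|j] //.
Qed.

End Geometry.

Theorem theorem3p1 (R : realType) :
  [/\ forall TT : nat -> seq (triangle R),
        leab_sequence TT ->
        let alpha0 := min_angle (TT 0%N) in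
        let alpha1 := min_angle (TT 1%N) in
        let c := min_diam (TT 1%N) in
        let C := max_diam (TT 1%N) in
        0 < alpha0 ->
        [/\ alpha0 / 2 <= alpha1,
            forall (k : nat) (T : triangle R), (1 <= k)%N -> T \in TT k ->
              c * sin alpha1 ^+ (k - 1) <= diam T /\
              diam T <= C * cos alpha1 ^+ (k - 1)
          & uniformly_refining TT],
      (* from level 2 on, every initial triangulation with small minimal angle
         produces diameters differing by a large factor *)
      forall (k : nat) (M : R), (2 <= k)%N ->
        exists2 delta : R, 0 < delta &
          forall TT : nat -> seq (triangle R), leab_sequence TT ->
            0 < min_angle (TT 0%N) -> min_angle (TT 0%N) < delta ->
            exists T T' : triangle R,
              [/\ T \in TT k, T' \in TT k & M * diam T' < diam T]
    & (* such triangulations exist, and on level 1 some of them do as well *)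
      forall (k : nat) (M delta : R), (1 <= k)%N -> 0 < delta ->
        exists TT : nat -> seq (triangle R),
          [/\ leab_sequence TT, 0 < min_angle (TT 0%N),
              min_angle (TT 0%N) < delta
            & exists T T' : triangle R,
                [/\ T \in TT k, T' \in TT k & M * diam T' < diam T]]].
Proof.
split.
- move=> TT TTP alpha0 alpha1 c C a0; split.
  + exact: half_alpha0_le_alpha1.
  + move=> [//|k] T _ TS; rewrite subSS subn0.
    have [h [s [t [rT _ _ lo up]]]] := leab_right_triangle TT TTP a0 k T TS.
    by rewrite (diam_right_triangle rT).
  + exact: leab_uniformly_refining.
- move=> [|[|n]] // M _.
  have [delta [d0 dpi dcos dM]] := cos_close_to_one M.
  exists delta => // TT [[_ nd _] step] _ ad.
  have [T [i [TS Ti]]] := min_angle_lt _ _ dpi ad.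
  have [j [ej sub]] := leab_step_children _ _ _ (step 0%N) TS.
  have cos1 := nondegenerate_cosine_lt1 T i (nd _ TS).
  have ci : cos delta < cosine T i.
    have : -1 <= cosine T i <= 1 by apply/andP; split; nra.
    move=> c1; rewrite ltNge -le_acos ?(ltW d0) ?dpi //.
    by rewrite -ltNge -angleE.
  have [T1 [T2 [cE r1 r2]]] := nondegenerate_children T j (nd _ TS) ej.
  have T1S : T1 \in TT 1%N by apply: sub; rewrite cE mem_head.
  have T2S : T2 \in TT 1%N by apply: sub; rewrite cE !inE eqxx orbT.
  have disparity T' h s t : T' \in TT 1%N -> right_triangle T' h s t ->
      cos delta < s -> exists T T' : triangle R,
        [/\ T \in TT n.+2, T' \in TT n.+2 & M * diam T' < diam T].
    move=> T'S rT' ds; have [_ s0 t0 st _] := rT'.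
    exact: (right_triangle_disparity TT 1 n.+1 T' h s t M step T'S rT'
             (dM s t s0 t0 st ds)).
  (* A thin angle at an end of the longest edge passes to the child on its side, where its cosine is
     the shape coordinate [s]. *)
  have [ij|ij|ij] := I3_cases j i; rewrite ij in ci.
  (* Opposite a longest edge x the cosine is at most 1/2, since y^2 + z^2 - x^2 <= y z. *)
  + exfalso; have e0 l : 0 < edge T l by apply: nondegenerate_edge_gt0; apply: nd.
    have le l : edge T l <= edge T j by rewrite ej diam_ge.
    have : 1 / 2 < cosine T j by lra.
    have := e0 (j + 1); have := e0 (j + 2); have := le (j + 1); have := le (j + 2).
    rewrite /cosine ltr_pdivlMr ?mulr_gt0 //.
    move: (edge _ _) (edge _ _) (edge _ _) => x y z; nra.
  + exact: disparity T1S r1 ci.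
  + exact: disparity T2S r2 ci.
- move=> [//|n] M delta _ d0.
  have [d1 [d10 d1pi d1cos d1M]] := cos_close_to_one M.
  (* Halving puts [phi] strictly below both [delta] and [d1]. *)
  pose phi := Num.min delta d1 / 2.
  have phi0 : 0 < phi by rewrite divr_gt0 // lt_min d0.
  have [phid phid1] : phi < delta /\ phi < d1.
    have : Num.min delta d1 <= delta by rewrite ge_min lexx.
    have : Num.min delta d1 <= d1 by rewrite ge_min lexx orbT.
    by move: phi0; rewrite /phi; lra.
  have phi_itv : 0 <= phi <= pi by rewrite ltW //= ltW // (lt_le_trans phid1).
  have cphi : cos d1 < cos phi by rewrite ltr_cos // in_itv //= ltW.
  have c0 : 0 < cos phi by lra.
  have s0 : 0 < sin phi by rewrite sin_gt0_pi // phi0 (lt_le_trans phid1).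
  have rT := right_triangle_of_angleP phi c0 s0.
  set T := right_triangle_of_angle phi in rT.
  have [TT [TTP TT0]] := exists_leab_sequence _
    (triangulation1 _ (right_triangle_nondegenerate rT)).
  have TS : T \in TT 0%N by rewrite TT0 mem_head.
  have [c1 s1] := right_triangle_legs_lt1 rT.
  have [_ _ _ _ [r [er _]]] := rT.
  have [cos0 coss] := right_triangle_cosines r er rT.
  exists TT; split=> //.
  + rewrite TT0 /min_angle big_cons big_nil lt_min pi_gt0 andbT.
    apply: lt_bigmin => [|i _]; first exact: pi_gt0.
    rewrite angleE; apply: acos_gt0; apply/andP.
    by have [->|->|->] := I3_cases r i; rewrite ?cos0;
      case: coss => -[_ _ e1 e2]; rewrite ?e1 ?e2; lra.
  + apply: le_lt_trans phid; rewrite -[leRHS](@cosK R) ?in_itv //.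
    by case: coss => -[_ _ e1 e2]; [rewrite -e1|rewrite -e2];
      rewrite -angleE min_angle_le.
  + have [_ step] := TTP.
    (* The initial triangle is already right, so counting starts at level 0 and level 1 is
       covered. *)
    apply: (right_triangle_disparity TT 0 n.+1 T _ _ _ M step TS rT _ isT).
    by apply: d1M => //; rewrite cos2Dsin2.
Qed.
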